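(* Let $\mathfrak{g}$ be a Lie algebra over a field $\mathbb{F}$, and let $M$ be a left $\mathfrak{g}$-module. Then the left hemi-semidirect product $\mathfrak{g}\ltimes_\ell M$ is simple (as a left Leibniz algebra) if, and only if, $\mathfrak{g}$ is simple and either $M=0$ or $M$ is a non-trivial irreducible $\mathfrak{g}$-module.
   Context: The field $\mathbb{F}$ is arbitrary, and $\mathfrak{g}$ and $M$ may have arbitrary dimension. Ideals are two-sided. A left Leibniz algebra is an $\mathbb{F}$-vector space $\mathfrak{L}$ with a bilinear multiplication satisfying $x(yz)=(xy)z+y(xz)$ for all $x,y,z\in\mathfrak{L}$. Its Leibniz kernel is the ideal $\mathrm{Leib}(\mathfrak{L}):=\langle x^2\mid x\in\mathfrak{L}\rangle_{\mathbb{F}}$ and its derived subalgebra is $\mathfrak{L}^2:=\langle xy\mid x,y\in\mathfrak{L}\rangle_{\mathbb{F}}$ (linear spans). A left Leibniz algebra $\mathfrak{L}$ is called simple if $0$, $\mathrm{Leib}(\mathfrak{L})$, $\mathfrak{L}$ are the only ideals of $\mathfrak{L}$, and $\mathrm{Leib}(\mathfrak{L})\subsetneqq\mathfrak{L}^2$. For Lie algebras this is the usual notion: non-abelian with no ideals other than $0$ and itself. For a Lie algebra $\mathfrak{g}$ and a left $\mathfrak{g}$-module $M$ (i.e. $[x,y]\cdot m=x\cdot(y\cdot m)-y\cdot(x\cdot m)$), the left hemi-semidirect product $\mathfrak{g}\ltimes_\ell M$ is the vector space $\mathfrak{g}\times M$ with multiplication $(g,m)(g',m'):=([g,g'],g\cdot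 m')$; it is a left Leibniz algebra. An irreducible module is by definition non-zero. A module $M$ is trivial if $g\cdot m=0$ for all $g\in\mathfrak{g}$, $m\in M$, and non-trivial otherwise. *)

(* Defs.v *)
From HB Require Import structures.
From mathcomp Require Import all_boot all_order all_algebra.
From mathcomp Require Import boolp classical_sets.

Set Implicit Arguments.
Unset Strict Implicit.
Unset Printing Implicit Defensive.

Import GRing.Theory.
Local Open Scope classical_set_scope.
Local Open Scope ring_scope.

HB.mixin Record isLeftLeibniz (F : fieldType) L of GRing.Lmodule F L := {
  lmul : L -> L -> L;
  lmul_is_bilinear : bilinear_for *:%R *:%R lmul;
  lmul_leibniz : forall x y z : L,
    lmul x (lmul y z) = lmul (lmul x y) z + lmul y (lmul x z)
}.

#[short(type="leftLeibnizType")]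
HB.structure Definition LeftLeibniz (F : fieldType) :=
  { L of GRing.Lmodule F L & isLeftLeibniz F L }.

Notation "x *L y" := (lmul x y) (at level 40, left associativity) : ring_scope.

HB.instance Definition _ (F : fieldType) (L : leftLeibnizType F) :=
  bilinear_isBilinear.Build F L L L _ _ (@lmul F L) lmul_is_bilinear.

Section LeftLeibnizTheory.
Variables (F : fieldType) (L : leftLeibnizType F).
Implicit Types x y z : L.

Lemma lmulDl x y z : (x + y) *L z = x *L z + y *L z.
Proof. exact: linearDl. Qed.

Lemma lmulDr x y z : x *L (y + z) = x *L y + x *L z.
Proof. exact: linearDr. Qed.

Lemma lmulNr x y : x *L (- y) = - (x *L y).
Proof. exact: linearNr. Qed.

Lemma lmulPl (a : F) x y z : (a *: x + y) *L z = a *: (x *L z) + y *L z.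
Proof. exact: linearPl. Qed.

Lemma lmulPr (a : F) x y z : x *L (a *: y + z) = a *: (x *L y) + x *L z.
Proof. exact: linearPr. Qed.

End LeftLeibnizTheory.

(* For an alternating product the left Leibniz identity is the Jacobi identity,
   so a Lie algebra is a left Leibniz algebra with x *L x = 0. The factory
   [isLieAlgebra] builds one from the Jacobi identity in its usual form, and
   [lie_jacobi] recovers it. *)
HB.mixin Record LeftLeibniz_isLie (F : fieldType) L of LeftLeibniz F L := {
  lmulxx : forall x : L, x *L x = 0
}.

#[short(type="lieAlgType")]
HB.structure Definition LieAlgebra (F : fieldType) :=
  { L of LeftLeibniz F L & LeftLeibniz_isLie F L }.

HB.factory Record isLieAlgebra (F : fieldType) L of GRing.Lmodule F L := {
  brk : L -> L -> L;
  brk_is_bilinear : bilinear_for *:%R *:%R brk;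
  brkxx : forall x : L, brk x x = 0;
  brk_jacobi : forall x y z : L,
    brk x (brk y z) + brk y (brk z x) + brk z (brk x y) = 0
}.

HB.builders Context F L of isLieAlgebra F L.

HB.instance Definition _ := bilinear_isBilinear.Build F L L L _ _ brk brk_is_bilinear.

Lemma brkC x y : brk x y = - brk y x.
Proof.
apply/eqP; rewrite -subr_eq0 opprK; apply/eqP.
by have := brkxx (x + y); rewrite linearDl /= !linearDr /= !brkxx add0r addr0.
Qed.

Lemma brk_leibniz x y z : brk x (brk y z) = brk (brk x y) z + brk y (brk x z).
Proof.
apply/eqP; rewrite -subr_eq0 -[X in _ == X](brk_jacobi x y z) opprD -addrA.
rewrite (brkC (brk x y)) opprK -linearNr -(brkC z x).
by rewrite (addrC (brk z _)).
Qed.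

HB.instance Definition _ := isLeftLeibniz.Build F L brk_is_bilinear brk_leibniz.
HB.instance Definition _ := LeftLeibniz_isLie.Build F L brkxx.

HB.end.

HB.mixin Record isLieModule (F : fieldType) (g : lieAlgType F) M
    of GRing.Lmodule F M := {
  mact : g -> M -> M;
  mact_is_bilinear : bilinear_for *:%R *:%R mact;
  mact_lmul : forall (x y : g) (m : M),
    mact (x *L y) m = mact x (mact y m) - mact y (mact x m)
}.

#[short(type="lieModType")]
HB.structure Definition LieModule (F : fieldType) (g : lieAlgType F) :=
  { M of GRing.Lmodule F M & isLieModule F g M }.

Notation "x *A m" := (mact x m) (at level 40, left associativity) : ring_scope.

HB.instance Definition _ (F : fieldType) (g : lieAlgType F) (M : lieModType g) :=
  bilinear_isBilinear.Build F g M M _ _ (@mact F g M) mact_is_bilinear.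

Section LieModuleTheory.
Variables (F : fieldType) (g : lieAlgType F) (M : lieModType g).

Lemma mactPl (a : F) (x y : g) (m : M) :
  (a *: x + y) *A m = a *: (x *A m) + y *A m.
Proof. by case: (@mact_is_bilinear F g M) => /(_ m) /(_ a x y). Qed.

Lemma mactPr (a : F) (x : g) (m n : M) :
  x *A (a *: m + n) = a *: (x *A m) + x *A n.
Proof. by case: (@mact_is_bilinear F g M) => _ /(_ x) /(_ a m n). Qed.

End LieModuleTheory.

Section Subspaces.
Variables (F : fieldType) (V : lmodType F).

Definition subspace (U : set V) : Prop :=
  U 0 /\ forall (a : F) (u v : V), U u -> U v -> U (a *: u + v).

Definition lspan (A : set V) : set V := smallest subspace A.

Lemma subspace_lspan (A : set V) : subspace (lspan A).
Proof.
split=> [U [[U0 _] _] //|a u v Au Av U UA].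
by have [[_ UP] _] := UA; apply: UP; [exact: Au|exact: Av].
Qed.

End Subspaces.

Section Leibniz.
Variables (F : fieldType) (L : leftLeibnizType F).

Definition ideal (I : set L) : Prop :=
  subspace I /\ forall x y : L, I y -> I (x *L y) /\ I (y *L x).

Definition Leib : set L := lspan [set x *L x | x in [set: L]].

Definition derived : set L := lspan [set z | exists x y : L, z = x *L y].

Definition simple_leibniz : Prop :=
  (forall I : set L, ideal I -> [\/ I = [set 0], I = Leib | I = [set: L]])
  /\ Leib `<` derived.

End Leibniz.

Arguments Leib {F} L.
Arguments derived {F} L.
Arguments simple_leibniz {F} L.

Section LieTheory.
Variables (F : fieldType) (g : lieAlgType F).

Lemma lmulC (x y : g) : x *L y = - (y *L x).
Proof.
apply/eqP; rewrite -subr_eq0 opprK; apply/eqP.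
by have := lmulxx (x + y); rewrite lmulDl !lmulDr !lmulxx add0r addr0.
Qed.

Lemma lie_jacobi (x y z : g) :
  x *L (y *L z) + y *L (z *L x) + z *L (x *L y) = 0.
Proof.
rewrite lmul_leibniz (lmulC z x) lmulNr (lmulC z).
by rewrite addrK subrr.
Qed.

Lemma Leib_lie : Leib g = [set 0].
Proof.
apply/seteqP; split=> x; last by move=> ->; exact: (subspace_lspan _).1.
apply; split; last by move=> _ [y _ <-]; exact: lmulxx.
by split=> // a u v -> ->; rewrite scaler0 addr0.
Qed.

Lemma simple_lieP :
  simple_leibniz g <->
  (exists x y : g, x *L y <> 0) /\
  (forall I : set g, ideal I -> I = [set 0] \/ I = [set: g]).
Proof.
have zsub : subspace [set (0 : g)].
  by split=> // a u v -> ->; rewrite scaler0 addr0.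
rewrite /simple_leibniz Leib_lie; split=> [[sg [_ nd]]|[[x [y xy0]] sg]].
  split; last by move=> I /sg[]; [left|left|right].
  apply: contrapT => nxy; apply: nd; apply: smallest_sub => // z [x [y ->]].
  by apply: contrapT => xy0; apply: nxy; exists x, y.
split; first by move=> I /sg[]; [constructor 1|constructor 3].
split=> [_ ->|]; first by exact: (subspace_lspan _).1.
move=> d0; apply: xy0; apply: (d0 (x *L y)) => U [_ sU].
by apply: sU; exists x, y.
Qed.

End LieTheory.

Section LieModules.
Variables (F : fieldType) (g : lieAlgType F) (M : lieModType g).

Definition submodule (N : set M) : Prop :=
  subspace N /\ forall (x : g) (m : M), N m -> N (x *A m).

Definition irreducible_module : Prop :=
  [set: M] <> [set 0] /\
  forall N : set M, submodule N -> N = [set 0] \/ N = [set: M].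

Definition trivial_module : Prop := forall (x : g) (m : M), x *A m = 0.

End LieModules.

Arguments irreducible_module {F g} M.
Arguments trivial_module {F g} M.

(* The product type carries the direct sum vector space structure; a separate
   name is used so that no Leibniz product is attached to [g * M] itself. *)
Definition hemi_semidirect (F : fieldType) (g : lieAlgType F)
  (M : lieModType g) : Type := (g * M)%type.

Section HemiSemidirect.
Variables (F : fieldType) (g : lieAlgType F) (M : lieModType g).

HB.instance Definition _ := GRing.Lmodule.on (hemi_semidirect M).

Definition hemi_mul (p q : hemi_semidirect M) : hemi_semidirect M :=
  (p.1 *L q.1, p.1 *A q.2).

Lemma hemi_mul_is_bilinear : bilinear_for *:%R *:%R hemi_mul.
Proof.
by split=> [q|p] a u v; rewrite /hemi_mul /= ?(lmulPl, lmulPr, mactPl, mactPr).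
Qed.

Lemma hemi_mul_leibniz (x y z : hemi_semidirect M) :
  hemi_mul x (hemi_mul y z) =
  hemi_mul (hemi_mul x y) z + hemi_mul y (hemi_mul x z).
Proof.
have e : x.1 *A (y.1 *A z.2) = (x.1 *L y.1) *A z.2 + y.1 *A (x.1 *A z.2).
  by rewrite mact_lmul subrK.
exact: (congr2 pair (lmul_leibniz x.1 y.1 z.1) e).
Qed.

HB.instance Definition _ := isLeftLeibniz.Build F (hemi_semidirect M)
  hemi_mul_is_bilinear hemi_mul_leibniz.

End HemiSemidirect.

Arguments hemi_semidirect {F} g M.

(* Main.v *)
(** In the hemi-semidirect product the squares are the vectors (0, x m), so the
    Leibniz kernel is 0 x gM. If I is an ideal of g and N a submodule of M, then
    I x M and 0 x N are ideals of the product, which gives one direction. For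
    the converse, let J be an ideal of the product; its projection to g is an
    ideal of g. If the projection is 0, then J = 0 x N for a submodule N. If it
    is g, then J contains all products (x, m)(0, n) = (0, x n) with x in g, hence
    0 x gM; as gM = M by hypothesis, J is everything. *)
Require Import Defs.
From mathcomp Require Import all_boot all_order all_algebra.
From mathcomp Require Import boolp classical_sets.

Set Implicit Arguments.
Unset Strict Implicit.
Unset Printing Implicit Defensive.

Import GRing.Theory.
Local Open Scope classical_set_scope.
Local Open Scope ring_scope.

Lemma lspan_sub (F : fieldType) (V : lmodType F) (A : set V) : A `<=` lspan A.
Proof. exact: sub_smallest. Qed.

Lemma subspace0 (F : fieldType) (V : lmodType F) : subspace [set (0 : V)].
Proof. by split=> // a u v -> ->; rewrite scaler0 addr0. Qed.

Lemma Leib_sub_derived (F : fieldType) (L : leftLeibnizType F) :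
  Leib L `<=` derived L.
Proof.
apply: smallest_sub; first exact: subspace_lspan.
by move=> _ [x _ <-]; apply: lspan_sub; exists x, x.
Qed.

Section HemiIdeals.
Variables (F : fieldType) (g : lieAlgType F) (M : lieModType g).
Local Notation H := (hemi_semidirect g M).

Lemma mact0l (m : M) : (0 : g) *A m = 0.
Proof. exact: linear0l. Qed.

Lemma lmul0l (y : g) : 0 *L y = 0.
Proof. exact: linear0l. Qed.

Lemma lmul0r (y : g) : y *L 0 = 0.
Proof. exact: linear0r. Qed.

Definition prod_set (I : set g) (N : set M) : set H :=
  [set p | I p.1 /\ N p.2].

Lemma subspace_prod_set (I : set g) (N : set M) :
  subspace I -> subspace N -> subspace (prod_set I N).
Proof.
move=> [I0 IP] [N0 NP]; split=> [//|a u v [Iu Nu] [Iv Nv]].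
by split; [exact: IP|exact: NP].
Qed.

Lemma subspace_snd (J : set H) :
  subspace J -> subspace [set m : M | J (0, m)].
Proof.
move=> [J0 JP]; split=> [//|a u v Ju Jv].
have e : a *: (0 : g) + 0 = 0 by rewrite scaler0 addr0.
by have := JP a _ _ Ju Jv; congr (J _); exact: (congr2 pair e (erefl _)).
Qed.

Lemma ideal_prod_setT (I : set g) : ideal I -> ideal (prod_set I [set: M]).
Proof.
move=> [sI II]; split; first exact: subspace_prod_set.
by move=> x y [Iy _]; have [] := II x.1 y.1 Iy.
Qed.

(** The product ignores the module component of its left factor, so right multiplication kills 0 x
    N; only left multiplication needs [N] to be stable under the action. *)
Lemma ideal_prod_set0 (N : set M) :
  submodule N -> ideal (prod_set [set 0] N).
Proof.
move=> [sN NN]; split; first exact: subspace_prod_set (@subspace0 F g) sN.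
move=> [x m] [y n] [/= -> Nn]; split; split=> /=.
- exact: lmul0r.
- exact: NN.
- exact: lmul0l.
- by rewrite mact0l; exact: sN.1.
Qed.

Lemma Leib_hemi_fst (p : H) : Leib H p -> p.1 = 0.
Proof.
move=> Lp.
have [] // : prod_set [set 0] [set: M] p.
apply: Lp; split; first exact: subspace_prod_set (@subspace0 F g) _.
by move=> _ [q _ <-]; split=> //; exact: lmulxx.
Qed.

Lemma Leib_hemi_mact (x : g) (m : M) : Leib H (0, x *A m).
Proof.
apply: lspan_sub; exists ((x, m) : H) => //.
exact: (congr2 pair (lmulxx x) (erefl _)).
Qed.

Lemma Leib_hemi_trivial : trivial_module M -> Leib H = [set 0].
Proof.
move=> tM; apply/seteqP; split=> [p|p ->]; last exact: (subspace_lspan _).1.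
apply; split; first exact: subspace0.
by move=> _ [q _ <-]; exact: (congr2 pair (lmulxx q.1) (tM q.1 q.2)).
Qed.

(** If M is irreducible, the n with (0, n) in the kernel form a submodule containing gM;
    non-triviality makes it non-zero, hence it is all of M. *)
Lemma Leib_hemiE :
  [set: M] = [set 0] \/ (irreducible_module M /\ ~ trivial_module M) ->
  forall p : H, Leib H p <-> p.1 = 0.
Proof.
move=> hM [x m]; split=> [/Leib_hemi_fst //|/= ->].
have [L0 _] := subspace_lspan [set q *L q | q in [set: H]].
case: hM => [M0|[[_ irr] ntM]].
  by have -> : m = 0 by have : [set: M] m by []; rewrite M0.
have sN : submodule [set n : M | Leib H (0, n)].
  split; first exact: subspace_snd (subspace_lspan _).
  by move=> y n _; exact: Leib_hemi_mact.
case: (irr _ sN) => NE; last by have : [set: M] m by []; rewrite -NE.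
case: ntM => y n.
have : [set n : M | Leib H (0, n)] (y *A n) := Leib_hemi_mact y n.
by rewrite NE.
Qed.

Lemma ideal_fst (J : set H) :
  ideal J -> ideal [set x : g | exists m, J (x, m)].
Proof.
move=> [[J0 JP] JJ]; split.
  split=> [|a u v [m Ju] [n Jv]]; first by exists 0.
  by exists (a *: m + n); exact: (JP a (u, m) (v, n)).
move=> x y [m Jy]; have [Jl Jr] := JJ ((x, 0) : H) _ Jy.
by split; [exists (x *A m)|exists (y *A 0)].
Qed.

Lemma ideal_snd (J : set H) :
  ideal J -> submodule [set m : M | J (0, m)].
Proof.
move=> [sJ JJ]; split; first exact: subspace_snd.
move=> x m Jm; have [+ _] := JJ ((x, 0) : H) _ Jm.
by congr (J _); exact: (congr2 pair (lmul0r x) (erefl _)).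
Qed.

End HemiIdeals.

Section Simplicity.
Variables (F : fieldType) (g : lieAlgType F) (M : lieModType g).
Local Notation H := (hemi_semidirect g M).

Lemma simple_hemi_lie : simple_leibniz H -> simple_leibniz g.
Proof.
move=> [sH [_ nd]]; apply/simple_lieP; split.
  (* If g were abelian, every product would have the form (0, x n) and lie in the Leibniz kernel,
     against the strict inclusion. *)
  apply: contrapT => nxy; apply: nd; apply: smallest_sub.
    exact: subspace_lspan.
  move=> _ [p [q ->]].
  have := Leib_hemi_mact p.1 q.2; congr (Leib H _).
  congr pair; apply/esym; apply: contrapT => pq0.
  by apply: nxy; exists p.1, q.1.
move=> I iI.
(* Both 0 and the Leibniz kernel project to 0 in g, so one argument covers two of the three cases
   for I x M. *)
have fstI (J : set H) : J `<=` [set p | p.1 = 0] ->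
    prod_set I [set: M] = J -> I = [set 0].
  move=> J0 IJ; apply/seteqP; split=> [x Ix|x ->]; last exact: iI.1.1.
  by apply: (J0 ((x, 0) : H)); rewrite -IJ.
case: (sH _ (ideal_prod_setT M iI)) => [/fstI IE|/fstI IE|IE].
- by left; apply: IE => _ ->.
- by left; apply: IE; exact: Leib_hemi_fst.
- right; apply/seteqP; split=> // x _.
  by have : [set: H] (x, 0) by []; rewrite -IE => -[].
Qed.

(** As g is non-zero, 0 x N is never the whole product, so it is the kernel whenever N is non-zero.
    Comparing N with M itself gives irreducibility; a trivial action would make the kernel 0. *)
Lemma simple_hemi_module : simple_leibniz H -> [set: M] <> [set 0] ->
  irreducible_module M /\ ~ trivial_module M.
Proof.
move=> sH M0; have /simple_lieP[[x [y xy0]] _] := simple_hemi_lie sH.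
have subH (N : set M) : submodule N ->
    N = [set 0] \/ prod_set [set 0] N = Leib H.
  move=> sN; case: (sH.1 _ (ideal_prod_set0 sN)) => NE; [left|by right|].
    apply/seteqP; split=> [m Nm|m ->]; last exact: sN.1.1.
    have : prod_set [set 0] N (0, m) by [].
    by rewrite NE => -[].
  have : [set: H] (x, 0) by [].
  rewrite -NE => -[/= x0 _].
  by case: xy0; rewrite x0 lmul0l.
have LE : prod_set [set 0] [set: M] = Leib H.
  by case: (subH [set: M]).
split; first split=> // N sN.
  case: (subH _ sN) => [|NE]; [by left|right].
  apply/seteqP; split=> // m _.
  have : prod_set [set (0 : g)] [set: M] (0, m) by [].
  by rewrite LE -NE => -[].
move=> /Leib_hemi_trivial L0; apply: M0; apply/seteqP; split=> // m _.
have : prod_set [set (0 : g)] [set: M] (0, m) by [].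
by rewrite LE L0 => -[].
Qed.

Lemma hemi_simple : simple_leibniz g ->
    [set: M] = [set 0] \/ (irreducible_module M /\ ~ trivial_module M) ->
  simple_leibniz H.
Proof.
move=> /simple_lieP[[x [y xy0]] sg] hM; have LE := Leib_hemiE hM.
split; last first.
  split; first exact: Leib_sub_derived.
  move=> dL; apply: xy0.
  (* This product has first component [x *L y], while elements of the kernel have first component
     0. *)
  have /dL/Leib_hemi_fst // : derived H (((x, 0) : H) *L ((y, 0) : H)).
  by apply: lspan_sub; exists (x, 0), (y, 0).
have irr (N : set M) : submodule N -> N = [set 0] \/ N = [set: M].
  case: hM => [M0 sN|[[_ +] _]]; last exact.
  by left; apply/seteqP; split=> [m _|_ ->]; [rewrite -M0|exact: sN.1.1].
move=> J iJ; have [[J0 JP] JJ] := iJ.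
case: (sg _ (ideal_fst iJ)) => JE.
  have J1 p : J p -> p.1 = 0.
    case: p => z m Jp; have : [set z : g | exists m, J (z, m)] z by exists m.
    by rewrite JE.
  case: (irr _ (ideal_snd iJ)) => NE; [constructor 1|constructor 2].
    apply/seteqP; split=> [[z m] Jp|_ -> //].
    have z0 : z = 0 := J1 _ Jp.
    move: Jp; rewrite z0 => Jm; congr pair.
    by have : [set m : M | J (0, m)] m by []; rewrite NE.
  apply/seteqP; split=> [p /J1/LE //|[z m] /LE/= ->].
  by have : [set: M] m by []; rewrite -NE.
constructor 3; apply/seteqP; split=> // -[z m] _.
have [n Jz] : [set z : g | exists m, J (z, m)] z by rewrite JE.
have LJ : Leib H `<=` J.
  apply: smallest_sub => // _ [[u k] _ <-].
  have [l Ju] : [set z : g | exists m, J (z, m)] u by rewrite JE.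
  (* The lift (u, l) in [J] may differ from (u, k), but (u, l)(u, k) is the square of (u, k), since
     the product does not see l. *)
  have [_ +] := JJ ((u, k) : H) _ Ju.
  by [].
(* Two lifts of z differ by an element of 0 x M, which is the kernel. The scalar 1 below turns
   closure under [a *: u + v] into closure under sums. *)
have Jm : J (0, m - n) by apply/LJ/LE.
have e1 : 1 *: z + 0 = z by rewrite scale1r addr0.
have e2 : 1 *: n + (m - n) = m by rewrite scale1r addrC subrK.
by have := JP 1 _ _ Jz Jm; congr (J _); exact: (congr2 pair e1 e2).
Qed.

End Simplicity.

Theorem theorem2p3 (F : fieldType) (g : lieAlgType F) (M : lieModType g) :
  simple_leibniz (hemi_semidirect g M) <->
  simple_leibniz g /\
  ((forall m : M, m = 0%R) \/ (irreducible_module M /\ ~ trivial_module M)).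
Proof.
have M0P : [set: M] = [set 0] <-> forall m : M, m = 0.
  split=> [M0 m|M0]; first by have : [set: M] m by []; rewrite M0.
  by apply/seteqP; split=> // m _; exact: M0.
split=> [sH|[sg [/M0P M0|hM]]].
- split; first exact: simple_hemi_lie sH.
  have [/M0P M0|] := pselect ([set: M] = [set 0]); first by left.
  by right; exact: simple_hemi_module.
- by apply: hemi_simple => //; left.
- by apply: hemi_simple => //; right.
Qed.
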